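(* Assume the following condition (A) on data generating processes: (i) for each $t^\ast\in\{0,1\}$, $Z$ is independent of $(Y_{t^\ast},T^\ast_0,T^\ast_1)$; (ii) $T^\ast_1\ge T^\ast_0$ almost surely; (iii) $0<P(Z=0)<1$. Let $P$ be an arbitrary distribution of the observed variables $(Y,T,Z)$. Then the sharp identified set $\Theta_I(P)$ for the local average treatment effect is as follows: $\Theta_I(P)=\Theta$ if $TV_Y=0$; otherwise $$ \Theta_I(P)=\begin{cases} \left[\Delta E_P[Y\mid Z],\ \dfrac{\Delta E_P[Y\mid Z]}{TV_Y}\right] & \text{if }\Delta E_P[Y\mid Z]>0,\\ \{0\} & \text{if }\Delta E_P[Y\mid Z]=0,\\ \left[\dfrac{\Delta E_P[Y\mid Z]}{TV_Y},\ \Delta E_P[Y\mid Z]\right] & \text{if }\Delta E_P[Y\mid Z]<0. \end{cases} $$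
   Context: Variables. $Z\in\{0,1\}$ is a binary instrument; $T^\ast_z\in\{0,1\}$ ($z=0,1$) is the counterfactual true treatment when $Z=z$; $Y_{t^\ast}$ (real-valued) and $T_{t^\ast}\in\{0,1\}$ ($t^\ast=0,1$) are the counterfactual outcome and the counterfactual measured treatment when the true treatment equals $t^\ast$. (Here $T_{t^\ast}$ may be dependent on $Z$.) Outcomes have distributions dominated by a known finite measure $\mu_Y$ on the real line. The (unobserved) true treatment is $T^\ast=T^\ast_Z$; the observed variables are $(Y,T,Z)$ with $Y=Y_{T^\ast}$ and $T=T_{T^\ast}$. A data generating process $P^\ast$ is a joint distribution of $(Y_0,Y_1,T_0,T_1,T^\ast_0,T^\ast_1,Z)$; $P^\ast_{(Y,T,Z)}$ denotes the distribution of $(Y,T,Z)$ it induces. $\mathcal P^\ast$ is the set of all $P^\ast$ satisfying condition (A) of the claim. The distribution $P$ of $(Y,T,Z)$ satisfies $0<P(Z=0)<1$, $E_P|Y|<\infty$, and $Y$ is dominated by $\mu_Y$. The local average treatment effect is $\theta(P^\ast)=E_{P^\ast}[Y_1-Y_0\mid T^\ast_0<T^\ast_1]$. The parameter space $\Theta$ is the set of all numbers $\int y f_1(y)\,d\mu_Y(y)-\int y f_0(y)\,d\mu_Y(y)$ where $f_0,f_1$ are probability densities with respect to $\mu_Y$ (with finite first moments). The sharp identified set is $$\Theta_I(P)=\{\theta(P^\ast)\in\Theta:\ P^\ast\in\mathcal P^\ast,\ P^\ast_{(Y,T,Z)}=P\}.$$ Convention: if $P^\ast(T^\ast_0<T^\ast_1)=0$,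 the conditional laws of $Y_1$ and $Y_0$ given the null event $\{T^\ast_0<T^\ast_1\}$ may be specified arbitrarily (with $\mu_Y$-densities), so that $\theta(P^\ast)$ is then allowed to be any element of $\Theta$. Notation: $\Delta E_P[X\mid Z]=E_P[X\mid Z=1]-E_P[X\mid Z=0]$, and $TV_Y=\frac12\int|f_{Y\mid Z=1}(y)-f_{Y\mid Z=0}(y)|\,d\mu_Y(y)$, where $f_{Y\mid Z=z}$ is the conditional density of $Y$ given $Z=z$ with respect to $\mu_Y$. *)

(* Defs.v *)
From HB Require Import structures.
From mathcomp Require Import all_boot all_order all_algebra.
From mathcomp Require Import all_classical all_reals all_analysis.

Set Implicit Arguments.
Unset Strict Implicit.
Unset Printing Implicit Defensive.

Import Order.TTheory GRing.Theory Num.Theory.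
Import numFieldNormedType.Exports.

Local Open Scope classical_set_scope.
Local Open Scope ring_scope.

(* P( . | A); the second argument of mnormalize is the default value taken when
   P A = 0, where conditioning is meaningless. *)
Definition cond_prob d (T : measurableType d) (R : realType)
    (P : probability T R) (A : set T) (mA : measurable A) : probability T R :=
  mnormalize (mrestr P mA) P.

Lemma measurable_preimage_bool d (T : measurableType d)
  (X : {mfun T >-> bool}) (b : bool) : measurable (X @^-1` [set b]).
Proof.
by rewrite -[X in measurable X]setTI; exact: (measurable_funPT X).
Qed.

Definition independent_RVs d d1 d2 (T : measurableType d)
    (T1 : measurableType d1) (T2 : measurableType d2) (R : realType)
    (P : probability T R) (X : {mfun T >-> T1}) (Y : {mfun T >-> T2}) : Prop :=
  forall (A : set T1) (B : set T2), measurable A -> measurable B ->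
    P (X @^-1` A `&` Y @^-1` B) = (P (X @^-1` A) * P (Y @^-1` B))%E.

Notation obs_space R := (R * bool * bool)%type (only parsing).

Section observed.
Context {R : realType}.

Definition Yobs (x : obs_space R) : R := x.1.1.
Definition Zobs (x : obs_space R) : bool := x.2.

Lemma measurable_Yobs : measurable_fun setT Yobs.
Proof. exact: measurableT_comp measurable_fst measurable_fst. Qed.
HB.instance Definition _ := isMeasurableFun.Build _ _ _ _ Yobs measurable_Yobs.

Lemma measurable_Zobs : measurable_fun setT Zobs.
Proof. exact: measurable_snd. Qed.
HB.instance Definition _ := isMeasurableFun.Build _ _ _ _ Zobs measurable_Zobs.

Variable P : probability (obs_space R) R.

Definition condZ (z : bool) : probability (obs_space R) R :=
  cond_prob P (measurable_preimage_bool Zobs z).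

Definition DeltaEY : R :=
  fine ('E_(condZ true)[Yobs])%E - fine ('E_(condZ false)[Yobs])%E.

Variable muY : {finite_measure set R -> \bar R}.

(* a version of f_{Y | Z = z}, meaningful when the law of Y is dominated *)
Definition densY (z : bool) (y : R) : R :=
  fine (Radon_Nikodym
    (charge_of_finite_measure (distribution (condZ z) Yobs)) muY y).

Definition TVY : R :=
  2^-1 * \int[muY]_y `|densY true y - densY false y|.

End observed.

(* ((Y_0, Y_1), (T_0, T_1), (T*_0, T*_1), Z) *)
Notation dgp_space R :=
  ((R * R) * (bool * bool) * (bool * bool) * bool)%type (only parsing).

Section counterfactuals.
Context {R : realType}.
Implicit Types (w : dgp_space R) (t z : bool).

Definition Ycf t w : R := if t then w.1.1.1.2 else w.1.1.1.1.
Definition Tcf t w : bool := if t then w.1.1.2.2 else w.1.1.2.1.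
Definition Tstar z w : bool := if z then w.1.2.2 else w.1.2.1.
Definition Zdgp w : bool := w.2.

(* T* = T*_Z *)
Definition Treal w : bool := Tstar (Zdgp w) w.

(* (Y, T, Z) with Y = Y_{T*} and T = T_{T*} *)
Definition obs_of w : obs_space R :=
  (Ycf (Treal w) w, Tcf (Treal w) w, Zdgp w).

(* (Y_t, T*_0, T*_1) *)
Definition outcome_type t w : obs_space R :=
  (Ycf t w, Tstar false w, Tstar true w).

Definition compliers : set (dgp_space R) :=
  [set w | (Tstar false w < Tstar true w)%N].

Lemma measurable_Ycf t : measurable_fun setT (Ycf t).
Proof.
have m3 : measurable_fun setT (fun w : dgp_space R => w.1.1.1).
  apply: measurableT_comp measurable_fst _.
  by apply: measurableT_comp measurable_fst _; exact: measurable_fst.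
by case: t; [exact: measurableT_comp measurable_snd m3
            |exact: measurableT_comp measurable_fst m3].
Qed.
HB.instance Definition _ t :=
  isMeasurableFun.Build _ _ _ _ (Ycf t) (measurable_Ycf t).

Lemma measurable_Tcf t : measurable_fun setT (Tcf t).
Proof.
have m3 : measurable_fun setT (fun w : dgp_space R => w.1.1.2).
  apply: measurableT_comp measurable_snd _.
  by apply: measurableT_comp measurable_fst _; exact: measurable_fst.
by case: t; [exact: measurableT_comp measurable_snd m3
            |exact: measurableT_comp measurable_fst m3].
Qed.
HB.instance Definition _ t :=
  isMeasurableFun.Build _ _ _ _ (Tcf t) (measurable_Tcf t).

Lemma measurable_Tstar z : measurable_fun setT (Tstar z).
Proof.
have m3 : measurable_fun setT (fun w : dgp_space R => w.1.2).
  by apply: measurableT_comp measurable_snd _; exact: measurable_fst.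
by case: z; [exact: measurableT_comp measurable_snd m3
            |exact: measurableT_comp measurable_fst m3].
Qed.
HB.instance Definition _ z :=
  isMeasurableFun.Build _ _ _ _ (Tstar z) (measurable_Tstar z).

Lemma measurable_Zdgp : measurable_fun setT Zdgp.
Proof. exact: measurable_snd. Qed.
HB.instance Definition _ := isMeasurableFun.Build _ _ _ _ Zdgp measurable_Zdgp.

Lemma measurable_Treal : measurable_fun setT Treal.
Proof.
rewrite (_ : Treal = fun w => if Zdgp w then Tstar true w else Tstar false w).
  exact: measurable_fun_ifT measurable_Zdgp (measurable_Tstar true)
        (measurable_Tstar false).
by apply/funext => w; rewrite /Treal; case: (Zdgp w).
Qed.
HB.instance Definition _ :=
  isMeasurableFun.Build _ _ _ _ Treal measurable_Treal.

Lemma measurable_obs_of : measurable_fun setT obs_of.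
Proof.
apply/measurable_fun_pair; last exact: measurable_Zdgp.
apply/measurable_fun_pair.
- rewrite (_ : (fun w => _) =
    fun w => if Treal w then Ycf true w else Ycf false w).
    exact: measurable_fun_ifT measurable_Treal (measurable_Ycf true)
        (measurable_Ycf false).
  by apply/funext => w; case: (Treal w).
- rewrite (_ : (fun w => _) =
    fun w => if Treal w then Tcf true w else Tcf false w).
    exact: measurable_fun_ifT measurable_Treal (measurable_Tcf true)
        (measurable_Tcf false).
  by apply/funext => w; case: (Treal w).
Qed.
HB.instance Definition _ :=
  isMeasurableFun.Build _ _ _ _ obs_of measurable_obs_of.

Lemma measurable_outcome_type t : measurable_fun setT (outcome_type t).
Proof.
apply/measurable_fun_pair; last exact: measurable_Tstar.
by apply/measurable_fun_pair; [exact: measurable_Ycf|exact: measurable_Tstar].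
Qed.
HB.instance Definition _ t :=
  isMeasurableFun.Build _ _ _ _ (outcome_type t) (measurable_outcome_type t).

Lemma measurable_compliers : measurable compliers.
Proof.
rewrite (_ : compliers =
  Tstar false @^-1` [set false] `&` Tstar true @^-1` [set true]).
  by apply: measurableI; exact: measurable_preimage_bool.
apply/seteqP; split=> w; rewrite /compliers /=.
  by case: w.1.2.1; case: w.1.2.2.
by case=> -> ->.
Qed.

End counterfactuals.

Section identification.
Context {R : realType}.
Variable muY : {finite_measure set R -> \bar R}.
Implicit Types (Ps : probability (dgp_space R) R) (theta : R).

Definition outcomes_dominated Ps : Prop :=
  forall t : bool, distribution Ps (Ycf t) `<< muY.

Definition conditionA Ps : Prop :=
  [/\ forall t : bool, independent_RVs Ps (outcome_type t) Zdgp,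
      {ae Ps, forall w, (Tstar false w <= Tstar true w)%N} &
      (0 < Ps (Zdgp @^-1` [set false]) < 1)%E].

Definition is_integrable_density (f : R -> R) : Prop :=
  [/\ measurable_fun setT f,
      forall y, 0 <= f y,
      (\int[muY]_y (f y)%:E = 1)%E &
      muY.-integrable setT (fun y => (y * f y)%:E)].

Definition Theta : set R :=
  [set theta | exists f1 f0 : R -> R,
     [/\ is_integrable_density f1, is_integrable_density f0 &
      theta = \int[muY]_y (y * f1 y) - \int[muY]_y (y * f0 y)]].

(* theta is a value of E[Y_1 - Y_0 | T*_0 < T*_1]. This is a relation because
   the conditional laws given a null event are arbitrary, so that every element
   of Theta is a value when there are no compliers. The expectation is extended
   real, so it has no real value when it is not finite. *)
Definition is_LATE Ps theta : Prop :=
  if Ps compliers == 0%E then Theta theta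
  else theta%:E =
    ('E_(cond_prob Ps measurable_compliers)
       [fun w => (Ycf true w - Ycf false w)%R])%E.

Definition Theta_I (P : probability (obs_space R) R) : set R :=
  [set theta | Theta theta /\
     exists Ps : probability (dgp_space R) R,
       [/\ outcomes_dominated Ps,
           conditionA Ps,
           forall A : set (obs_space R), measurable A ->
             distribution Ps obs_of A = P A &
           is_LATE Ps theta]].

End identification.

(* Main.v *)
Require Import Defs.
From HB Require Import structures.
From mathcomp Require Import all_boot all_order all_algebra.
From mathcomp Require Import all_classical all_reals all_analysis.
From mathcomp Require Import measurable_realfun.
From mathcomp Require Import ring lra.

Set Implicit Arguments.
Unset Strict Implicit.
Unset Printing Implicit Defensive.

Import Order.TTheory GRing.Theory Num.Theory.
Import numFieldNormedType.Exports.

Local Open Scope classical_set_scope.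
Local Open Scope ring_scope.

(** Write [law z] for the law of the outcome given [Z = z], with density [dens z],
    and let [overlap] be the smaller of the two densities; its integral is
    [1 - TV].

    Necessity. Condition on [Z = z]: the observed outcome is [Y_1] for those with
    [T*_z = 1] and [Y_0] for the others, and by independence the conditioning may
    be dropped. Subtracting the two values of [z], always-takers and never-takers
    cancel by monotonicity, and for every Borel set [A]
<<
      law 1 A - law 0 A = P*(Y_1 in A, complier) - P*(Y_0 in A, complier)
>>
    ([law_balance]). Taking means, the local average treatment effect is
    [DE / p], where [p] is the share of compliers ([LATE_dgp]); evaluating at the
    set where the density under [Z = 1] is the larger one gives [TV <= p]
    ([TVY_le_compliers]). So the effect is [DE / p] for some [p] in [[TV, 1]], and
    these numbers form the stated interval ([ratio_range]).

    Sharpness. Every [p] in [[TV, 1]] is [1 - k * (1 - TV)] for some [k] in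
    [[0, 1]]. Starting from the observed [(Y, T, Z)], toss a coin that makes the
    unit a never-taker with probability [k * overlap Y / dens Z Y], and a complier
    otherwise. A never-taker gets [Y_0 = Y_1 = Y]. A complier gets [Y_Z = Y], and
    the missing outcome is drawn independently from the law of [Y] among compliers
    of the other arm. Both measured treatments are [T]. The observed law is
    reproduced by construction. Given either value of the instrument the
    never-takers have outcome density [k * overlap], and the compliers have
    density [dens t - k * overlap] in arm [t] ([mass_dgp_type]), whence the
    independence. The share of compliers is [p], and by the necessity part the
    effect is then [DE / p]. When [TV = 0], taking [k = 1] leaves no compliers and
    the effect is arbitrary. *)

(** * Finite masses, conditioning and means *)

Section mass.
Context d (T : measurableType d) (R : realType).
Implicit Types (mu : {finite_measure set T -> \bar R}) (P : probability T R).

(** Real-valued masses: every measure below is finite, and linear arithmetic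
    is available on [R] but not on the extended reals. *)
Definition mass mu (A : set T) : R := fine (mu A).

Lemma EFin_mass mu A : measurable A -> (mass mu A)%:E = mu A.
Proof. by move=> mA; rewrite /mass fineK// fin_num_measure. Qed.

Lemma mass_ge0 mu A : 0 <= mass mu A.
Proof. exact: fine_ge0. Qed.

Lemma massT P : mass P setT = 1.
Proof. exact: (congr1 fine (probability_setT P)). Qed.

Lemma massDI mu A B : measurable A -> measurable B ->
  mass mu A = mass mu (A `\` B) + mass mu (A `&` B).
Proof.
move=> mA mB; apply: EFin_inj; rewrite EFinD !EFin_mass//.
- exact: measureDI.
- exact: measurableI.
- exact: measurableD.
Qed.

Lemma massU mu A B : measurable A -> measurable B -> A `&` B = set0 ->
  mass mu (A `|` B) = mass mu A + mass mu B.
Proof.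
move=> mA mB AB0; apply: EFin_inj; rewrite EFinD !EFin_mass//.
- exact: measureU.
- exact: measurableU.
Qed.

Lemma le_mass mu A B : measurable A -> measurable B -> A `<=` B ->
  mass mu A <= mass mu B.
Proof. by move=> mA mB AB; rewrite -lee_fin !EFin_mass// le_measure// inE. Qed.

(** The product form also covers a null [A], where both sides vanish whatever
    default the conditional law takes. *)
Lemma mass_cond P A (mA : measurable A) B : measurable B ->
  mass P A * mass (cond_prob P mA) B = mass P (B `&` A).
Proof.
move=> mB; have -> : mass (cond_prob P mA) B =
    fine (if (P A == 0)%E || (P A == +oo)%E then P B
    else P (B `&` A) * (fine (P A))^-1%:E)%E.
  have -> : P A = mrestr P mA setT by exact: (congr1 P (esym (setTI A))).
  by rewrite /mass /= /mnormalize; case: ifP.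
rewrite /mass/=.
have -> : (P A == +oo%E) = false.
  by apply/negbTE; rewrite -ltey ltey_eq fin_num_measure.
rewrite orbF; case: ifPn => [/eqP PA0|PA0].
  rewrite PA0/= mul0r; apply/esym.
  have : mass P (B `&` A) <= mass P A by apply: le_mass => //; exact: measurableI.
  rewrite {2}/mass/= PA0/= => le0; apply/le_anti/andP; split=> //.
  exact: mass_ge0.
rewrite fineM//; last exact/fin_num_measure/measurableI.
by rewrite mulrCA mulfV ?mulr1// fine_eq0 ?fin_num_measure.
Qed.

(** A change of measure with density at most [c] keeps integrability: so the law
    of the outcome given the instrument, and the law of a counterfactual outcome
    given compliance, inherit a finite mean from the observed outcome. *)
Lemma integrable_le_mscale (mu nu : {measure set T -> \bar R}) (c : {nonneg R})
    (f : T -> \bar R) :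
  (forall A, measurable A -> (nu A <= c%:num%:E * mu A)%E) ->
  mu.-integrable setT f -> nu.-integrable setT f.
Proof.
move=> numu /integrableP[mf foo]; apply/integrableP; split=> //.
apply: (@le_lt_trans _ _ (\int[mscale c mu]_x `|f x|)%E).
  by apply: ge0_le_measure_integral => //; exact: measurableT_comp.
rewrite ge0_integral_mscale//; last exact: measurableT_comp.
by rewrite lte_mul_pinfty// ?lee_fin// ltey.
Qed.

End mass.

Section mean.
Context {R : realType}.
Implicit Types Q G : probability R R.

Definition has_mean Q : Prop := Q.-integrable setT EFin.

Definition mean Q : R := \int[Q]_y y.

Lemma has_mean_le_scale (c : R) Q G : 0 <= c ->
  (forall A, measurable A -> mass G A <= c * mass Q A) ->
  has_mean Q -> has_mean G.
Proof.
move=> c0 GQ; apply: (@integrable_le_mscale _ _ _ Q G (NngNum c0)) => A mA /=.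
by rewrite -EFin_mass// -[X in (_ * X)%E]EFin_mass// -EFinM lee_fin GQ.
Qed.

(** Subtraction is avoided because the difference of two laws is not a measure:
    both sides are integrals of the identity against one and the same measure. *)
Lemma mean_balance (p : R) Q1 Q0 G1 G0 : 0 <= p ->
  has_mean Q1 -> has_mean Q0 -> has_mean G1 -> has_mean G0 ->
  (forall A, measurable A ->
    mass Q1 A + p * mass G0 A = mass Q0 A + p * mass G1 A) ->
  mean Q1 + p * mean G0 = mean Q0 + p * mean G1.
Proof.
move=> p0 i1 i0 j1 j0 QG; pose c := NngNum p0.
have iG G : has_mean G -> (mscale c G).-integrable setT EFin.
  by apply: (@integrable_le_mscale _ _ _ G (mscale c G) c).
have EG G : has_mean G -> (\int[mscale c G]_y y%:E = (p * mean G)%:E)%E.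
  move=> hG; rewrite integralE !ge0_integral_mscale//; last 2 first.
  - by apply: measurable_funeneg; apply: measurable_int hG.
  - by apply: measurable_funepos; apply: measurable_int hG.
  rewrite -muleBr//; last first.
    rewrite fin_num_adde_defl// fin_numN integrable_fin_num//.
    exact: integrable_funeneg.
  by rewrite -integralE EFinM /mean /Rintegral fineK//; exact: integrable_fin_num.
have EQ Q : has_mean Q -> (\int[Q]_y y%:E = (mean Q)%:E)%E.
  by move=> hQ; rewrite /mean /Rintegral fineK//; exact: integrable_fin_num.
apply: EFin_inj; rewrite !EFinD -!EG// -!EQ//.
rewrite -!integral_measure_add//; try exact: iG.
apply: eq_measure_integral => A mA _.
rewrite [LHS]measure_addE [RHS]measure_addE /mscale/=.
have := congr1 EFin (QG A mA).
by rewrite !EFinD !EFinM !EFin_mass.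
Qed.

End mean.

Section bool_split.
Context d (T : measurableType d) (R : realType) (P : probability T R).

(** Independence from a binary variable needs to be checked at its two values
    only. *)
Lemma mass_bool_preimage (X : {mfun T >-> bool}) E B : measurable E ->
  mass P (E `&` X @^-1` B) =
  (true \in B)%:R * mass P (E `&` X @^-1` [set true]) +
  (false \in B)%:R * mass P (E `&` X @^-1` [set false]).
Proof.
move=> mE; have mX C : measurable (X @^-1` C).
  by rewrite -[X in measurable X]setTI; exact: (measurable_funPT X).
have part b : mass P (E `&` X @^-1` B `&` X @^-1` [set b]) =
    (b \in B)%:R * mass P (E `&` X @^-1` [set b]).
  case: (boolP (b \in B)) => [|/negP]; rewrite in_setE => bB.
    rewrite mul1r; congr mass; apply/seteqP; split=> x [].
      by move=> [Ex _] Xb.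
    by move=> Ex Xb; split=> //; split=> //; rewrite /preimage/= (Xb : X x = b).
  rewrite mul0r -[RHS](_ : mass P set0 = 0); last by rewrite /mass measure0.
  congr mass; apply/seteqP; split=> // x [[_ XB] Xb]; apply: bB.
  by rewrite -(Xb : X x = b).
rewrite (massDI _ (measurableI _ _ mE (mX B)) (mX [set false])).
rewrite part; congr (_ + _); rewrite -part; congr mass.
apply/seteqP; split=> x [[Ex XB] /= Xb]; split=> //.
  by rewrite /preimage/=; move: Xb; case: (X x) => // /(_ erefl).
by rewrite Xb.
Qed.

End bool_split.

(** * The observed law *)

Section observed_law.
Context {R : realType} (P : probability (obs_space R) R).

Definition pZ (z : bool) : R := mass P (Zobs @^-1` [set z]).

Definition law (z : bool) : probability R R := distribution (condZ P z) Yobs.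

Lemma mass_law z A : measurable A ->
  pZ z * mass (law z) A = mass P (Yobs @^-1` A `&` Zobs @^-1` [set z]).
Proof.
by move=> mA; apply: mass_cond; exact: measurable_funPTI.
Qed.

Lemma pZD : pZ true + pZ false = 1.
Proof.
rewrite -(massT P) -massU; try exact: measurable_preimage_bool.
  by congr mass; apply/seteqP; split=> // x _ /=; case: (Zobs x); [left|right].
by apply/seteqP; split=> // x [/= ->].
Qed.

Hypothesis hZ : (0 < P (Zobs @^-1` [set false]) < 1)%E.

Lemma pZ_gt0 z : 0 < pZ z.
Proof.
have [h0 h1] : 0 < pZ false /\ pZ false < 1.
  case/andP: hZ; rewrite -(EFin_mass P (measurable_preimage_bool _ _)).
  by rewrite lte_fin lte_fin.
by case: z => //; have := pZD; lra.
Qed.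

Hypothesis hY : P.-integrable setT (EFin \o Yobs).

Lemma integrable_condZ z : (condZ P z).-integrable setT (EFin \o Yobs).
Proof.
have pz0 : 0 <= (pZ z)^-1 by rewrite invr_ge0 ltW ?pZ_gt0.
apply: (@integrable_le_mscale _ _ _ P _ (NngNum pz0)) hY => A mA /=.
rewrite -EFin_mass// -[X in (_ * X)%E]EFin_mass// -EFinM lee_fin.
rewrite ler_pdivlMl ?pZ_gt0// mass_cond// le_mass//.
by apply: measurableI => //; exact: measurable_preimage_bool.
Qed.

Lemma has_mean_law z : has_mean (law z).
Proof.
by apply: integrable_pushforward => //; exact: integrable_condZ.
Qed.

Lemma DeltaEYE : DeltaEY P = mean (law true) - mean (law false).
Proof.
have E z : fine ('E_(condZ P z)[Yobs])%E = mean (law z).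
  rewrite unlock /mean /Rintegral integral_distribution//.
  exact: integrable_condZ.
by rewrite /DeltaEY !E.
Qed.

End observed_law.

(** * The complier identity *)

Section soundness.
Context {R : realType} (P : probability (obs_space R) R).
Variable Ps : probability (dgp_space R) R.
Hypothesis PsA : conditionA Ps.
Hypothesis PsP : forall A : set (obs_space R), measurable A ->
  distribution Ps obs_of A = P A.
Implicit Types (t z b : bool) (A : set R).

(* The potential treatment, read off a triple (outcome, T*_0, T*_1). *)
Let star z (x : obs_space R) : bool := if z then x.2 else x.1.2.

Let measurable_star z : measurable_fun setT (star z).
Proof.
case: z; first exact: measurable_snd.
exact: measurableT_comp measurable_snd measurable_fst.
Qed.

Definition Yarm t A z b : set (dgp_space R) :=
  Ycf t @^-1` A `&` Tstar z @^-1` [set b].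

Let mYpre A : measurable A -> measurable (@Yobs R @^-1` A).
Proof.
by move=> mA; exact: measurable_funPTI.
Qed.

Let mZpre z : measurable (@Zdgp R @^-1` [set z]).
Proof. exact: measurable_preimage_bool. Qed.

Lemma measurable_Ypre t A : measurable A -> measurable (@Ycf R t @^-1` A).
Proof.
by move=> mA; exact: measurable_funPTI.
Qed.

Lemma measurable_Tpre z b : measurable (@Tstar R z @^-1` [set b]).
Proof. exact: measurable_preimage_bool. Qed.

Lemma measurable_Yarm t A z b : measurable A -> measurable (Yarm t A z b).
Proof.
by move=> mA; apply: measurableI; [exact: measurable_Ypre|exact: measurable_Tpre].
Qed.

Lemma mass_Zdgp z : mass Ps (Zdgp @^-1` [set z]) = pZ P z.
Proof.
by congr fine; rewrite /= -PsP//; exact: (measurable_preimage_bool Zobs).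
Qed.

Lemma mass_Yarm_Z t A z b z' : measurable A ->
  mass Ps (Yarm t A z b `&` Zdgp @^-1` [set z']) =
  mass Ps (Yarm t A z b) * pZ P z'.
Proof.
move=> mA; rewrite -mass_Zdgp.
have mE : measurable (Yobs @^-1` A `&` star z @^-1` [set b] : set (obs_space R)).
  apply: measurableI; first exact: mYpre.
  by rewrite -[X in measurable X]setTI; exact: measurable_star.
have -> : Yarm t A z b =
    outcome_type t @^-1` (Yobs @^-1` A `&` star z @^-1` [set b]).
  by rewrite /Yarm; case: z {mE}.
have [ind _ _] := PsA; have := ind t _ [set z'] mE Logic.I.
rewrite /mass /= => ->; rewrite fineM// fin_num_measure//.
exact: measurable_funPTI.
Qed.

Hypothesis hZ : (0 < P (Zobs @^-1` [set false]) < 1)%E.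

(** Given [Z = z] the observed outcome is the counterfactual one for the treatment
    [T*_z]; independence then removes the conditioning on [Z], arm by arm. *)
Lemma mass_law_arms z A : measurable A ->
  mass (law P z) A =
  mass Ps (Yarm true A z true) + mass Ps (Yarm false A z false).
Proof.
move=> mA; apply: (mulfI (lt0r_neq0 (pZ_gt0 hZ z))).
rewrite mass_law// mulrDr ![pZ P z * _]mulrC -!mass_Yarm_Z// -massU.
- have mE : measurable (Yobs @^-1` A `&` Zobs @^-1` [set z] : set (obs_space R)).
    by apply: measurableI; [exact: mYpre|exact: measurable_preimage_bool].
  rewrite /mass /= -PsP//; congr (fine (Ps _)); apply/seteqP; split=> w.
    move=> [YA ZE]; have {YA} : A (Ycf (Tstar (Zdgp w) w) w) by [].
    rewrite (ZE : Zdgp w = z).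
    by case TE : (Tstar z w) => YA; [left|right].
  move=> [] [[YA TE] ZE]; split=> //;
    suff : A (Ycf (Tstar (Zdgp w) w) w) by [].
    by rewrite (ZE : Zdgp w = z) (TE : Tstar z w = true).
  by rewrite (ZE : Zdgp w = z) (TE : Tstar z w = false).
- by apply: measurableI => //; exact: measurable_Yarm.
- by apply: measurableI => //; exact: measurable_Yarm.
- apply/seteqP; split=> // w [[[_ T1] _] [[_ T0] _]].
  by have := etrans (esym (T1 : Tstar z w = true)) (T0 : Tstar z w = false).
Qed.

Lemma compliersE : @compliers R =
  Tstar false @^-1` [set false] `&` Tstar true @^-1` [set true].
Proof.
apply/seteqP; split=> w; rewrite /compliers /=.
  by case: w.1.2.1; case: w.1.2.2.
by case=> -> ->.
Qed.

Lemma mass_defiers E : measurable E ->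
  mass Ps (E `&` (Tstar false @^-1` [set true] `&` Tstar true @^-1` [set false]))
  = 0.
Proof.
move=> mE; set D := Tstar _ @^-1` _ `&` _.
have mD : measurable D by apply: measurableI; exact: measurable_Tpre.
have [_ mono _] := PsA.
have D0 : mass Ps D = 0.
  rewrite /mass/= (_ : Ps D = 0%E)//; apply/eqP.
  suff : Ps.-negligible D by move/negligibleP => /(_ mD) ->.
  by apply: negligibleS mono => w [/=]; rewrite /setC/= => -> ->.
apply/le_anti; rewrite mass_ge0 andbT -D0 le_mass//.
exact: measurableI.
Qed.

(** Under monotonicity the units treated when [Z = 1] are the always-takers and the
    compliers; dually in the next lemma for the units untreated when [Z = 0]. *)
Lemma mass_Tstar1 E : measurable E ->
  mass Ps (E `&` Tstar true @^-1` [set true]) =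
  mass Ps (E `&` Tstar false @^-1` [set true]) + mass Ps (E `&` compliers).
Proof.
move=> mE; have mT := measurable_Tpre.
rewrite (@massDI _ _ _ _ _ (Tstar false @^-1` [set false]))//; last first.
  exact: measurableI.
rewrite (@massDI _ _ _ _ (E `&` Tstar false @^-1` [set true])
  (Tstar true @^-1` [set false]))//; last exact: measurableI.
rewrite -[in X in _ = _ + X + _]setIA mass_defiers// addr0 compliersE.
by congr (_ + _); congr mass; apply/seteqP; split=> w /=;
  case: w.1.2.1; case: w.1.2.2; intuition discriminate.
Qed.

Lemma mass_Tstar0 E : measurable E ->
  mass Ps (E `&` Tstar false @^-1` [set false]) =
  mass Ps (E `&` Tstar true @^-1` [set false]) + mass Ps (E `&` compliers).
Proof.
move=> mE; have mT := measurable_Tpre.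
rewrite (@massDI _ _ _ _ _ (Tstar true @^-1` [set true]))//; last first.
  exact: measurableI.
rewrite (@massDI _ _ _ _ (E `&` Tstar true @^-1` [set false])
  (Tstar false @^-1` [set true]))//; last exact: measurableI.
rewrite -[in X in _ = _ + X + _]setIA (setIC (_ @^-1` [set false])).
rewrite mass_defiers// addr0 compliersE.
by congr (_ + _); congr mass; apply/seteqP; split=> w /=;
  case: w.1.2.1; case: w.1.2.2; intuition discriminate.
Qed.

Definition Ycompliers t A : R := mass Ps (Ycf t @^-1` A `&` compliers).

(** Always-takers and never-takers have the same observed outcome under both
    values of the instrument, so the two observed laws differ only through the
    compliers. This equality of measures carries the whole necessity part. *)
Lemma law_balance A : measurable A ->
  mass (law P true) A + Ycompliers false A =
  mass (law P false) A + Ycompliers true A.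
Proof.
move=> mA; rewrite !mass_law_arms// /Yarm.
rewrite mass_Tstar1 ?mass_Tstar0//; try exact: measurable_Ypre.
rewrite /Ycompliers; lra.
Qed.

(** Compliers show their outcome of arm [t] when [Z = t]. *)
Lemma Ycompliers_le t A : measurable A -> Ycompliers t A <= mass (law P t) A.
Proof.
move=> mA; rewrite mass_law_arms// /Yarm.
case: t; rewrite ?(mass_Tstar1 (measurable_Ypre _ mA)).
  rewrite /Ycompliers addrAC lerDr addr_ge0 //; exact: mass_ge0.
rewrite (mass_Tstar0 (measurable_Ypre _ mA)) /Ycompliers addrA lerDr.
by rewrite addr_ge0//; exact: mass_ge0.
Qed.

End soundness.

(** * Conditional densities and their overlap *)

Section slice_integral.
Context {R : realType} (P : probability (obs_space R) R).

(** Restricting [P] to the slice and pushing it forward along the outcome gives the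
    law given [Z = z], scaled by [P(Z = z)]. *)
Lemma ge0_integral_law z A (f : R -> \bar R) : measurable A ->
  measurable_fun setT f -> (forall y, 0 <= f y)%E ->
  (\int[P]_(x in Yobs @^-1` A `&` Zobs @^-1` [set z]) f (Yobs x) =
   (pZ P z)%:E * \int[law P z]_(y in A) f y)%E.
Proof.
move=> mA mf f0; pose mZ := measurable_preimage_bool (@Zobs R) z.
have mYA : measurable (@Yobs R @^-1` A).
  exact: measurable_funPTI.
have mfY : measurable_fun setT (f \o @Yobs R).
  exact: measurableT_comp mf (@measurable_Yobs R).
pose mu := mrestr P mZ.
transitivity (\int[mu]_(x in Yobs @^-1` A) f (Yobs x))%E.
  rewrite (@ge0_negligible_integral _ _ _ mu _ (~` (Zobs @^-1` [set z])))//.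
  - rewrite setDE setCK; apply: eq_measure_integral => B mB BAZ.
    by rewrite /= /mu /mrestr setIidl// => x /BAZ[].
  - exact: measurableC.
  - exact: measurable_funTS.
  - by rewrite /= /mu /mrestr setICl measure0.
have pz0 : 0 <= pZ P z by exact: mass_ge0.
rewrite -(@ge0_integral_mscale _ _ _ _ _ _ (NngNum pz0))//; last first.
  exact: measurable_funTS.
rewrite -(@ge0_integral_pushforward _ _ _ _ _ Yobs _ mu A f)//; last first.
  exact: measurable_funTS.
apply: eq_measure_integral => B mB _.
rewrite /= /mscale/= -[X in (_ * X)%E](@EFin_mass _ _ _ (law P z))//.
rewrite -EFinM mass_law// EFin_mass//.
apply: measurableI => //; exact: measurable_funPTI.
Qed.

End slice_integral.

Section densities.
Context {R : realType} (muY : {finite_measure set R -> \bar R}).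
Variable P : probability (obs_space R) R.
Hypothesis hZ : (0 < P (Zobs @^-1` [set false]) < 1)%E.
Hypothesis hdom : distribution P Yobs `<< muY.

Lemma law_dominated z : law P z `<< muY.
Proof.
apply/null_content_dominatesP => A mA A0.
have PA0 : P (Yobs @^-1` A) = 0%E by move/null_content_dominatesP : hdom; apply.
have mYA : measurable (@Yobs R @^-1` A).
  exact: measurable_funPTI.
have mZ := measurable_preimage_bool (@Zobs R) z.
have : pZ P z * mass (law P z) A <= mass P (Yobs @^-1` A).
  by rewrite mass_law// le_mass//; exact: measurableI.
rewrite {2}/mass/= PA0/= pmulr_rle0 ?pZ_gt0// => le0.
rewrite -[LHS]EFin_mass//; congr EFin; apply/le_anti.
by rewrite le0 mass_ge0.
Qed.

(** The nonnegative version of the Radon-Nikodym derivative, so that inequalities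
    between densities hold everywhere and not just almost everywhere. *)
Definition dens (z : bool) (y : R) : R :=
  fine (Radon_Nikodym_SigmaFinite.f (law P z) muY y).

Let RNE z : Radon_Nikodym_SigmaFinite.f (law P z) muY = EFin \o dens z.
Proof.
apply/funext => y /=; rewrite /dens fineK//.
exact/Radon_Nikodym_SigmaFinite.f_fin_num/law_dominated.
Qed.

Lemma dens_ge0 z y : 0 <= dens z y.
Proof. exact/fine_ge0/Radon_Nikodym_SigmaFinite.f_ge0/law_dominated. Qed.

Lemma integrable_dens z : muY.-integrable setT (EFin \o dens z).
Proof.
by rewrite -RNE; exact/Radon_Nikodym_SigmaFinite.f_integrable/law_dominated.
Qed.

Lemma measurable_dens z : measurable_fun setT (dens z).
Proof. exact/measurable_EFinP/measurable_int/integrable_dens. Qed.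

Lemma mass_law_dens z A : measurable A ->
  mass (law P z) A = \int[muY]_(y in A) dens z y.
Proof.
move=> mA; rewrite /mass [X in fine X](@Radon_Nikodym_SigmaFinite.f_integral
  _ _ _ _ muY)//; last exact: law_dominated.
by rewrite RNE.
Qed.

Lemma ge0_integral_dens z A (f : R -> \bar R) : measurable A ->
  measurable_fun setT f -> (forall y, 0 <= f y)%E ->
  (\int[law P z]_(y in A) f y = \int[muY]_(y in A) (f y * (dens z y)%:E))%E.
Proof.
move=> mA mf f0; rewrite -(@Radon_Nikodym_SigmaFinite.change_of_variables
  _ _ _ _ muY)//; first by rewrite RNE.
- exact: law_dominated.
- exact: measurable_funTS.
Qed.

(** Hence total variation may be computed from the nonnegative version. *)
Lemma densY_ae z : ae_eq muY setT (densY P muY z) (dens z).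
Proof.
apply: ae_eq_sym; have := @ae_eq_Radon_Nikodym_SigmaFinite _ _ _ (law P z) muY
  (law_dominated z) setT measurableT.
exact: ae_eq_comp.
Qed.

Lemma integrable_mul_dens z : has_mean (law P z) ->
  muY.-integrable setT (fun y => (y * dens z y)%:E).
Proof.
move=> iz; apply/integrableP; split.
  by apply/measurable_EFinP/measurable_funM => //; exact: measurable_dens.
move/integrableP : iz => [_]; rewrite ge0_integral_dens//.
  congr (_ < _)%E; apply: eq_integral => y _.
  by rewrite /= normrM (ger0_norm (dens_ge0 _ _)) EFinM.
exact: measurableT_comp.
Qed.

Lemma mean_law z : has_mean (law P z) ->
  mean (law P z) = \int[muY]_y (y * dens z y).
Proof.
move=> iz; rewrite /mean /Rintegral; congr fine.
rewrite -(@Radon_Nikodym_change_of_variables _ _ _ _ muY)//; last first.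
  exact: law_dominated.
apply: ae_eq_integral => //.
- apply: emeasurable_funM => //; apply: measurable_int.
  exact/Radon_Nikodym_integrable/law_dominated.
- by apply/measurable_EFinP/measurable_funM => //; exact: measurable_dens.
- have := ae_eq_Radon_Nikodym_SigmaFinite (law_dominated z) measurableT.
  by rewrite RNE; apply: filterS => y h yT; rewrite /= -(h yT) EFinM.
Qed.

Definition overlap (y : R) : R := Num.min (dens true y) (dens false y).

Lemma overlap_ge0 y : 0 <= overlap y.
Proof. by rewrite le_min !dens_ge0. Qed.

Lemma overlap_le z y : overlap y <= dens z y.
Proof. by rewrite ge_min; case: z; rewrite lexx ?orbT. Qed.

Lemma measurable_overlap : measurable_fun setT overlap.
Proof. by apply: measurable_minr; exact: measurable_dens. Qed.

Lemma integrable_overlap : muY.-integrable setT (EFin \o overlap).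
Proof.
apply: le_integrable (integrable_dens true) => //.
  by apply/measurable_EFinP; exact: measurable_overlap.
move=> y _ /=; rewrite lee_fin !ger0_norm ?overlap_ge0 ?dens_ge0//.
exact: overlap_le.
Qed.

(** From [|a - b| = a + b - 2 min(a, b)] and the densities having mass one. *)
Lemma integral_overlap : \int[muY]_y overlap y = 1 - TVY P muY.
Proof.
have TVE : TVY P muY = 2^-1 * \int[muY]_y `|dens true y - dens false y|.
  congr (_ * _); rewrite /Rintegral; congr fine; apply: ae_eq_integral => //.
  - apply/measurable_EFinP/measurableT_comp => //; apply: measurable_funB;
      apply: measurableT_comp => //; apply: measurable_int;
      exact/Radon_Nikodym_integrable/law_dominated.
  - apply/measurable_EFinP/measurableT_comp => //.
    by apply: measurable_funB; exact: measurable_dens.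
  - have := ae_eq_sub (densY_ae true) (densY_ae false).
    by move/(ae_eq_comp (fun r => (`|r|)%:E)).
have normE y : `|dens true y - dens false y| =
    dens true y + dens false y - 2 * overlap y.
  rewrite /overlap; have [|] := leP (dens true y) (dens false y) => h.
    by rewrite ler0_norm ?subr_le0//; lra.
  by rewrite gtr0_norm ?subr_gt0//; lra.
have dens1 z : \int[muY]_y dens z y = 1 by rewrite -mass_law_dens// massT.
have TVE' : \int[muY]_y `|dens true y - dens false y| =
    \int[muY]_y (dens true y + dens false y - 2 * overlap y).
  by apply: eq_Rintegral => y _; exact: normE.
rewrite TVE TVE'.
rewrite RintegralB//; last 2 first.
- apply: (integrableD measurableT (integrable_dens _) (integrable_dens _)).
- exact: integrableZl integrable_overlap.
rewrite RintegralD//; [|exact: integrable_dens..].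
by rewrite RintegralZl ?dens1//; [lra|exact: integrable_overlap].
Qed.

Lemma integral_overlap_setC A : measurable A ->
  \int[muY]_y overlap y =
  \int[muY]_(y in A) overlap y + \int[muY]_(y in ~` A) overlap y.
Proof.
move=> mA; rewrite -(setUv A) Rintegral_setU//.
- exact: measurableC.
- by rewrite setUv; exact: integrable_overlap.
- by rewrite disj_set2E setICr.
Qed.

End densities.

(** * Splitting the sample into never-takers and compliers *)

Section coin.
Context {R : realType}.

(* The uniform law lives on another copy of the measurable space of the reals;
   pushing it forward along the identity moves it to the one used for outcomes. *)
Let uniform_draw : measurableTypeR R -> R := idfun.

Let measurable_uniform_draw : measurable_fun setT uniform_draw.
Proof. exact: (@measurable_id _ _ setT). Qed.

HB.instance Definition _ := isMeasurableFun.Build _ _ _ _ uniform_draw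
  measurable_uniform_draw.

Definition coin : probability R R :=
  distribution (uniform_prob (@ltr01 R)) uniform_draw.

(** The event [u < k / d] written without division: it is empty for [d = 0], which
    is the right value since then [k = 0]. *)
Lemma coin_lt (k d : R) : 0 <= k <= d ->
  mass coin [set u | u * d < k] * d = k.
Proof.
case/andP=> k0 kd; have [d0|dgt] := leP d 0.
  have dE : d = 0 by lra.
  by rewrite dE mulr0; lra.
have -> : [set u | u * d < k] = `]-oo, (k / d)[%classic.
  by apply/seteqP; split=> u /=; rewrite in_itv /= ltr_pdivlMr.
have kd1 : k / d <= 1 by rewrite ler_pdivrMr ?mul1r.
have kd0 : 0 <= k / d by rewrite divr_ge0// ltW.
suff -> : mass coin `]-oo, (k / d)[%classic = k / d by rewrite divfK ?gt_eqF.
rewrite /mass/= /distribution /pushforward /uniform_prob integral_uniform_pdf.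
have -> : `]-oo, (k / d)[ `&` `[0, 1] = `[0, (k / d)[%classic :> set R.
  apply/seteqP; split=> u; rewrite /= !in_itv/=.
    by case=> -> /andP[-> _].
  by case/andP=> -> h; split=> //; rewrite (le_trans (ltW h)).
rewrite (eq_integral (fun=> 1%E)); last first.
  move=> u; rewrite inE/= in_itv/= => /andP[u0 uk]; rewrite /uniform_pdf u0.
  by rewrite (le_trans (ltW uk) kd1) subr0 invr1.
rewrite integral_cst//= mul1e lebesgue_measure_itv/= lte_fin.
by case: ltP => //=; rewrite ?subr0 // => h; apply/le_anti; rewrite h kd0.
Qed.

End coin.

Section construction.
Context {R : realType} (muY : {finite_measure set R -> \bar R}).
Variable P : probability (obs_space R) R.
Hypothesis hZ : (0 < P (Zobs @^-1` [set false]) < 1)%E.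
Hypothesis hdom : distribution P Yobs `<< muY.
Variable k : R.
Hypothesis k01 : 0 <= k <= 1.

Local Notation dens := (dens muY P).
Local Notation overlap := (overlap muY P).
Local Notation law := (law P).
Local Notation pZ := (pZ P).

(** A unit observed at [(y, z)] is declared a never-taker with probability
    [k * overlap y / dens z y]. Multiplied by the density this no longer depends on
    [z], which is what makes the type independent of the instrument. *)
Definition never (v : obs_space R * R) : bool :=
  v.2 * dens (Zobs v.1) (Yobs v.1) < k * overlap (Yobs v.1).

Lemma measurable_never : measurable_fun setT never.
Proof.
have mY : measurable_fun setT (fun v : obs_space R * R => Yobs v.1).
  exact: measurableT_comp (@measurable_Yobs R) measurable_fst.
apply: measurable_fun_ltr.
  apply: measurable_funM; first exact: measurable_snd.
  rewrite (_ : (fun v => _) = fun v : obs_space R * R =>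
    if Zobs v.1 then dens true (Yobs v.1) else dens false (Yobs v.1)).
    apply: measurable_fun_ifT.
    - exact: measurableT_comp (@measurable_Zobs R) measurable_fst.
    - exact: measurableT_comp (measurable_dens hZ hdom true) mY.
    - exact: measurableT_comp (measurable_dens hZ hdom false) mY.
  by apply/funext => v; case: (Zobs _).
apply: measurable_funM => //.
exact: measurableT_comp (measurable_overlap hZ hdom) mY.
Qed.
HB.instance Definition _ :=
  isMeasurableFun.Build _ _ _ _ never measurable_never.

Definition obs_coin : probability (obs_space R * R)%type R := (P \x coin)%E.

Definition slice (A : set R) (z : bool) : set (obs_space R * R) :=
  (Yobs @^-1` A `&` Zobs @^-1` [set z]) `*` setT.

Lemma measurable_obs_slice A z : measurable A ->
  measurable (Yobs @^-1` A `&` Zobs @^-1` [set z] : set (obs_space R)).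
Proof.
move=> mA; apply: measurableI; last exact: measurable_preimage_bool.
exact: measurable_funPTI.
Qed.

Lemma measurable_slice A z : measurable A -> measurable (slice A z).
Proof. by move=> mA; apply: measurableX => //; exact: measurable_obs_slice. Qed.

Lemma mass_slice A z : measurable A ->
  mass obs_coin (slice A z) = pZ z * mass (law z) A.
Proof.
move=> mA; rewrite mass_law//; congr fine.
rewrite /slice [LHS]product_measure1E//; last exact: measurable_obs_slice.
by rewrite [X in (_ * X)%E]probability_setT mule1.
Qed.

(** Integrating out the coin leaves the share [k * overlap / dens z], and changing
    variables to the dominating measure cancels the density. *)
Lemma mass_slice_never A z : measurable A ->
  mass obs_coin (slice A z `&` never @^-1` [set true]) =
  pZ z * (k * \int[muY]_(y in A) overlap y).
Proof.
move=> mA.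
pose below y := [set u : R | u * dens z y < k * overlap y].
have mS : measurable [set v : R * R | v.2 * dens z v.1 < k * overlap v.1].
  rewrite -[X in measurable X]setTI.
  apply: (measurable_fun_ltr _ _ measurableT (Y := [set true])) => //.
    apply: measurable_funM; first exact: measurable_snd.
    exact: measurableT_comp (measurable_dens hZ hdom z) measurable_fst.
  apply: measurable_funM => //.
  exact: measurableT_comp (measurable_overlap hZ hdom) measurable_fst.
have belowE y : below y =
    xsection [set v : R * R | v.2 * dens z v.1 < k * overlap v.1] y.
  by apply/seteqP; split=> u /=; rewrite /xsection /= in_setE.
have mbelow y : measurable (below y).
  by rewrite belowE; exact: measurable_xsection.
have mshare : measurable_fun setT (fun y => coin (below y)).
  rewrite (_ : (fun y => _) = coin \o
    xsection [set v : R * R | v.2 * dens z v.1 < k * overlap v.1]).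
    exact: measurable_fun_xsection.
  by apply/funext => y; rewrite /= belowE.
have k_overlap y : 0 <= k * overlap y <= dens z y.
  case/andP: k01 => k0 k1; have := overlap_ge0 hZ hdom y.
  have := overlap_le muY P z y; nra.
apply: EFin_inj; rewrite EFin_mass; last first.
  apply: measurableI; first exact: measurable_slice.
  exact: measurable_preimage_bool.
transitivity (\int[P]_(x in Yobs @^-1` A `&` Zobs @^-1` [set z])
    coin (below (Yobs x)))%E.
  rewrite [RHS]integral_mkcond.
  transitivity (\int[P]_x
    coin (xsection (slice A z `&` never @^-1` [set true]) x))%E => //.
  apply: eq_integral => x _.
  rewrite /= patchE; case: ifPn => [|xD].
    rewrite inE => -[Ax zE]; congr (@coin R _); apply/seteqP.
    split=> u; rewrite /xsection/= in_setE /never /below /slice /=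
      (zE : Zobs x = z).
      by case.
    by move=> uk; split.
  transitivity (@coin R set0); last exact: measure0.
  congr (@coin R _); apply/seteqP; split=> // u.
  rewrite /xsection/= in_setE => -[[xA _] _].
  by move: xD; rewrite notin_setE.
rewrite (@ge0_integral_law _ _ _ _ (fun y => coin (below y)))//.
rewrite (ge0_integral_dens hZ hdom)// EFinM; congr (_ * _)%E.
transitivity (\int[muY]_(y in A) (k * overlap y)%:E)%E.
  apply: eq_integral => y _; rewrite -EFin_mass// -EFinM; congr EFin.
  exact: coin_lt.
rewrite -RintegralZl//; last first.
  exact: integrableS (integrable_overlap hZ hdom).
rewrite /Rintegral fineK// integrable_fin_num//.
apply: integrableS (integrableZl measurableT k (integrable_overlap hZ hdom)) => //.
Qed.

(** The density of the observed outcome given [Z = t] minus the part given to the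
    never-takers: the compliers' outcomes in arm [t], not normalized. *)
Definition complier_mass (t : bool) (A : set R) : R :=
  mass (law t) A - k * \int[muY]_(y in A) overlap y.

Lemma complier_massT t : complier_mass t setT = 1 - k * (1 - TVY P muY).
Proof. by rewrite /complier_mass massT integral_overlap. Qed.

Lemma mass_slice_complier A z : measurable A ->
  mass obs_coin (slice A z `&` never @^-1` [set false]) =
  pZ z * complier_mass z A.
Proof.
move=> mA; have mN b : measurable (never @^-1` [set b]).
  exact: measurable_preimage_bool.
have := massDI obs_coin (measurable_slice z mA) (mN true).
rewrite mass_slice// mass_slice_never// /complier_mass.
suff -> : slice A z `\` never @^-1` [set true] =
    slice A z `&` never @^-1` [set false] by lra.
apply/seteqP; split=> v /= [sv]; first by case: never => // /(_ erefl).
by move=> ->; split.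
Qed.

Lemma measurable_complier_slice t :
  measurable (slice setT t `&` never @^-1` [set false]).
Proof.
apply: measurableI; first exact: measurable_slice.
exact: measurable_preimage_bool.
Qed.

Lemma measurable_obs_outcome :
  measurable_fun setT (fun v : obs_space R * R => Yobs v.1).
Proof. exact: measurableT_comp (@measurable_Yobs R) measurable_fst. Qed.

Definition obs_outcome (v : obs_space R * R) : R := Yobs v.1.
HB.instance Definition _ :=
  isMeasurableFun.Build _ _ _ _ obs_outcome measurable_obs_outcome.

(** Conditioning the sample itself on being a complier with [Z = t] gives the
    normalized complier outcome law of arm [t] without building a measure from
    its density, and still makes sense when there are no compliers. *)
Definition complier_law (t : bool) : probability R R :=
  distribution (cond_prob obs_coin (measurable_complier_slice t)) obs_outcome.

Lemma mass_complier_law t A : measurable A ->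
  (1 - k * (1 - TVY P muY)) * mass (complier_law t) A = complier_mass t A.
Proof.
move=> mA; apply: (mulfI (lt0r_neq0 (pZ_gt0 hZ t))).
rewrite mulrA -(complier_massT t) -!mass_slice_complier//.
rewrite [mass (complier_law t) A]/mass /= mass_cond; last first.
  exact: measurable_funPTI.
congr mass; rewrite setIA; congr (_ `&` _); apply/seteqP; split=> v /=.
  by move=> [? [[_ ?] _]].
by move=> [[? ?] _].
Qed.

End construction.

(** * Drawing the missing counterfactual *)

Section missing_counterfactual.
Context {R : realType} (muY : {finite_measure set R -> \bar R}).
Variable P : probability (obs_space R) R.
Hypothesis hZ : (0 < P (Zobs @^-1` [set false]) < 1)%E.
Hypothesis hdom : distribution P Yobs `<< muY.
Variable k : R.
Hypothesis k01 : 0 <= k <= 1.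

Local Notation never := (never muY P k).
Local Notation overlap := (overlap muY P).
Local Notation p := (1 - k * (1 - TVY P muY)).
Local Notation G := (complier_law hZ hdom k).
Local Notation sample_space := ((obs_space R * R) * (R * R))%type.

Definition draws_law : probability (R * R)%type R := (G false \x G true)%E.

Definition sample_law : probability sample_space R :=
  (obs_coin P \x draws_law)%E.

Definition draw (t : bool) (yy : R * R) : R := if t then yy.2 else yy.1.

(** The observed outcome fills the arm of the observed instrument value, and both
    arms of a never-taker; a complier's other outcome is a fresh draw from the
    complier law of that arm. *)
Definition sample_Y (t : bool) (w : sample_space) : R :=
  if never w.1 || (Zobs w.1.1 == t) then Yobs w.1.1 else draw t w.2.

(** There are no always-takers. As the measured treatment may depend on the
    instrument, the observed one serves in both arms. *)
Definition sample_dgp (w : sample_space) : dgp_space R :=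
  ((sample_Y false w, sample_Y true w), (w.1.1.1.2, w.1.1.1.2),
   (false, ~~ never w.1), Zobs w.1.1).

Lemma measurable_sample_never : measurable_fun setT
  (fun w : sample_space => never w.1).
Proof. exact: measurableT_comp (measurable_never hZ hdom k) measurable_fst. Qed.

Lemma measurable_sample_Z : measurable_fun setT
  (fun w : sample_space => Zobs w.1.1).
Proof.
apply: measurableT_comp (@measurable_Zobs R) _.
exact: measurableT_comp measurable_fst measurable_fst.
Qed.

Lemma measurable_sample_Y t : measurable_fun setT (sample_Y t).
Proof.
apply: measurable_fun_ifT.
- apply: measurable_or; first exact: measurable_sample_never.
  rewrite (_ : (fun w => _) = fun w : sample_space =>
    if t then Zobs w.1.1 else ~~ Zobs w.1.1); last first.
    by apply/funext => w; case: t; case: Zobs.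
  case: t; first exact: measurable_sample_Z.
  exact: measurable_neg measurable_sample_Z.
- apply: measurableT_comp (@measurable_Yobs R) _.
  exact: measurableT_comp measurable_fst measurable_fst.
- by case: t; [exact: measurableT_comp measurable_snd measurable_snd
              |exact: measurableT_comp measurable_fst measurable_snd].
Qed.

Lemma measurable_sample_dgp : measurable_fun setT sample_dgp.
Proof.
have mT : measurable_fun setT (fun w : sample_space => w.1.1.1.2).
  apply: measurableT_comp measurable_snd _.
  apply: measurableT_comp measurable_fst _.
  exact: measurableT_comp measurable_fst measurable_fst.
apply/measurable_fun_pair; last exact: measurable_sample_Z.
apply/measurable_fun_pair.
  apply/measurable_fun_pair; last exact/measurable_fun_pair.
  by apply/measurable_fun_pair; exact: measurable_sample_Y.
apply/measurable_fun_pair; first exact: measurable_cst.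
exact: measurable_neg measurable_sample_never.
Qed.
HB.instance Definition _ :=
  isMeasurableFun.Build _ _ _ _ sample_dgp measurable_sample_dgp.

Definition dgp : probability (dgp_space R) R :=
  distribution sample_law sample_dgp.

Lemma obs_of_sample_dgp w : obs_of (sample_dgp w) = w.1.1.
Proof.
case: w => [[[[y b] z] u] yy].
rewrite /obs_of /Treal /sample_dgp /Ycf /Tcf /Tstar /Zdgp /sample_Y /Zobs /Yobs /=.
case: z => /=; last by rewrite orbT.
case: never => //=.
Qed.

(** Every event needed factors into one on the observation and its coin and one on
    the two fresh draws. *)
Lemma mass_dgp_rect (E : set (dgp_space R)) (A : set (obs_space R * R))
    (B : set (R * R)) :
  measurable E -> measurable A -> measurable B ->
  sample_dgp @^-1` E = A `*` B ->
  mass dgp E = mass (obs_coin P) A * mass draws_law B.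
Proof.
move=> mE mA mB EAB; apply: EFin_inj; rewrite EFinM !EFin_mass//.
transitivity (sample_law (A `*` B)); first by rewrite -EAB.
exact: product_measure1E.
Qed.

Lemma measurable_draw t (A : set R) : measurable A ->
  measurable (draw t @^-1` A).
Proof.
move=> mA; rewrite -[X in measurable X]setTI.
by case: t; [exact: measurable_snd|exact: measurable_fst].
Qed.

Lemma mass_draw t A : measurable A ->
  mass draws_law (draw t @^-1` A) = mass (G t) A.
Proof.
move=> mA; apply: EFin_inj; rewrite !EFin_mass//; last exact: measurable_draw.
case: t.
  rewrite (_ : draw true @^-1` A = setT `*` A); last first.
    by apply/seteqP; split=> x //= [].
  rewrite [LHS]product_measure1E//.
  by rewrite [X in (X * _)%E]probability_setT mul1e.
rewrite (_ : draw false @^-1` A = A `*` setT); last first.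
  by apply/seteqP; split=> x //= [].
rewrite [LHS]product_measure1E//.
by rewrite [X in (_ * X)%E]probability_setT mule1.
Qed.

Lemma distribution_dgp_obs A : measurable A -> distribution dgp obs_of A = P A.
Proof.
move=> mA.
transitivity (sample_law ((A `*` setT) `*` setT)).
  rewrite /distribution /pushforward; congr (sample_law _).
  apply/seteqP; split=> w; rewrite /preimage/= obs_of_sample_dgp//.
  by case=> [[]].
rewrite [LHS]product_measure1E//; last exact: measurableX.
rewrite [X in (_ * X)%E]probability_setT mule1.
by rewrite [LHS]product_measure1E// [X in (_ * X)%E]probability_setT mule1.
Qed.

(** The right-hand side is [P(Z = z)] times a quantity free of [z]. For a complier
    this holds for two reasons: in arm [t = z] the outcome is the observed one, and
    in the other arm it was drawn from the law that it would have had there. *)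
Lemma mass_dgp_type t z b A : measurable A ->
  mass dgp (Ycf t @^-1` A `&` Tstar true @^-1` [set b] `&` Zdgp @^-1` [set z]) =
  pZ P z * (if b then complier_mass muY P k t A
            else k * \int[muY]_(y in A) overlap y).
Proof.
move=> mA.
have mN c : measurable (never @^-1` [set c]).
  by rewrite -[X in measurable X]setTI; exact: (measurable_never hZ hdom k).
have mE : measurable (Ycf t @^-1` A `&` Tstar true @^-1` [set b]
    `&` Zdgp @^-1` [set z] : set (dgp_space R)).
  apply: measurableI; last exact: measurable_preimage_bool.
  exact: measurable_Yarm.
have mS A' c : measurable A' -> measurable (slice A' z `&` never @^-1` [set c]).
  by move=> mA'; apply: measurableI => //; exact: measurable_slice.
case: b mE => mE; last first.
  rewrite (@mass_dgp_rect _ (slice A z `&` never @^-1` [set true]) setT)//.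
  - by rewrite massT mulr1 (mass_slice_never hZ hdom).
  - exact: mS.
  - apply/seteqP; split=> w.
      move=> [[YA /= /negbFE N] zE]; split=> //; split=> //; split=> //.
      split=> //; move: YA; rewrite /preimage/= /Ycf/=.
      by case: (t); rewrite /sample_Y N.
    move=> [[[[YA zE] _] N] _]; split=> //; split.
      rewrite /preimage/= /Ycf/=.
      by case: (t); rewrite /sample_Y (N : never w.1 = true).
    by rewrite /preimage/= (N : never w.1 = true).
have [zt|zt] := eqVneq z t.
  subst t.
  rewrite (@mass_dgp_rect _ (slice A z `&` never @^-1` [set false]) setT)//.
  - by rewrite massT mulr1 (mass_slice_complier hZ hdom).
  - exact: mS.
  - apply/seteqP; split=> w.
      move=> [[YA /= /negbTE N] zE]; split=> //; split=> //; split=> //.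
      split=> //; move: YA; rewrite /preimage/= /Ycf/=.
      rewrite -(zE : Zobs w.1.1 = z).
      by case ZE : (Zobs _); rewrite /sample_Y ZE eqxx orbT.
    move=> [[[[YA zE] _] N] _]; split=> //; split.
      rewrite /preimage/= /Ycf/=.
      rewrite -(zE : Zobs w.1.1 = z).
      by case ZE : (Zobs _); rewrite /sample_Y ZE eqxx orbT.
    by rewrite /preimage/= (N : never w.1 = false).
rewrite (@mass_dgp_rect _ (slice setT z `&` never @^-1` [set false])
  (draw t @^-1` A))//.
- rewrite mass_draw// (mass_slice_complier hZ hdom)// -mulrA.
  by rewrite (complier_massT hZ hdom) mass_complier_law.
- exact: mS.
- exact: measurable_draw.
- apply/seteqP; split=> w.
    move=> [[YA /= /negbTE N] zE]; split=> //.
    move: YA; rewrite /preimage/= /Ycf/=.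
    have := zt; rewrite -(zE : Zobs w.1.1 = z) => /negbTE zt'.
    by move: zt'; case: (t) => zt'; rewrite /sample_Y N zt'.
  move=> [[[[_ zE] _] N] YA]; split=> //; split; last first.
    by rewrite /preimage/= (N : never w.1 = false).
  rewrite /preimage/= /Ycf/=.
  have := zt; rewrite -(zE : Zobs w.1.1 = z) => /negbTE.
  move: YA; rewrite /preimage /=.
  by case: (t) => YA zt'; rewrite /sample_Y (N : never w.1 = false) zt'.
Qed.

End missing_counterfactual.

Section matching_dgp.
Context {R : realType} (muY : {finite_measure set R -> \bar R}).
Variable P : probability (obs_space R) R.
Hypothesis hZ : (0 < P (Zobs @^-1` [set false]) < 1)%E.
Hypothesis hdom : distribution P Yobs `<< muY.
Variable k : R.
Hypothesis k01 : 0 <= k <= 1.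

Local Notation overlap := (overlap muY P).
Local Notation Ps := (dgp hZ hdom k).

(** The common law of [(Y_t, T*_0, T*_1)] under both values of the instrument;
    [T*_0] is always false. *)
Definition type_mass (t : bool) (B : set (obs_space R)) : R :=
  k * \int[muY]_(y in [set y | B (y, false, false)]) overlap y +
  complier_mass muY P k t [set y | B (y, false, true)].

Lemma measurable_type_section (a b : bool) (B : set (obs_space R)) :
  measurable B -> measurable [set y | B (y, a, b)].
Proof.
move=> mB; rewrite -[X in measurable X]setTI.
have : measurable_fun setT (fun y : R => (y, a, b)).
  by apply/measurable_fun_pair => //; apply/measurable_fun_pair.
exact.
Qed.

Lemma mass_dgp_outcome_Z t z B : measurable B ->
  mass Ps (outcome_type t @^-1` B `&` Zdgp @^-1` [set z]) =
  pZ P z * type_mass t B.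
Proof.
move=> mB; pose S b := [set y | B (y, false, b)].
have mS b : measurable (S b) by exact: measurable_type_section.
pose E b : set (dgp_space R) :=
  Ycf t @^-1` S b `&` Tstar true @^-1` [set b] `&` Zdgp @^-1` [set z].
have mE b : measurable (E b).
  apply: measurableI; last exact: measurable_preimage_bool.
  exact: measurable_Yarm.
transitivity (mass Ps (E false `|` E true)).
  rewrite /mass/= /distribution /pushforward; congr (fine (sample_law _ _ _ _)).
  apply/seteqP; split=> w.
    move=> [Bw Zw]; have {Bw} : B (Ycf t (sample_dgp muY P k w), false,
      Tstar true (sample_dgp muY P k w)) by [].
    by case Tw : (Tstar true (sample_dgp muY P k w)) => Bw; [right|left].
  move=> [] [[Sw Tw] Zw]; split=> //;
    suff : B (Ycf t (sample_dgp muY P k w), false,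
      Tstar true (sample_dgp muY P k w)) by [].
    by rewrite (Tw : Tstar true (sample_dgp muY P k w) = false).
  by rewrite (Tw : Tstar true (sample_dgp muY P k w) = true).
rewrite massU//; last first.
  apply/seteqP; split=> // w [[[_ Tw] _] [[_ Tw'] _]].
  by have := etrans (esym (Tw : Tstar true w = false)) (Tw' : Tstar true w = true).
by rewrite /E !mass_dgp_type//= -mulrDr.
Qed.

Lemma measurable_outcome_pre t (B : set (obs_space R)) : measurable B ->
  measurable (outcome_type t @^-1` B).
Proof.
by move=> mB; exact: measurable_funPTI.
Qed.

Lemma mass_dgp_outcome t B : measurable B ->
  mass Ps (outcome_type t @^-1` B) = type_mass t B.
Proof.
move=> mB; have := mass_bool_preimage Ps Zdgp setT (measurable_outcome_pre t mB).
rewrite preimage_setT setIT !in_setT !mass_dgp_outcome_Z// => ->.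
by rewrite !mul1r -mulrDl pZD mul1r.
Qed.

(** Never-takers and compliers together rebuild the observed law of arm [t], so
    domination is inherited. *)
Lemma mass_dgp_Ycf t A : measurable A ->
  mass Ps (Ycf t @^-1` A) = mass (law P t) A.
Proof.
move=> mA; have mYA : measurable (@Yobs R @^-1` A).
  exact: measurable_funPTI.
have := mass_dgp_outcome t mYA.
rewrite /type_mass /complier_mass [X in k * X](_ : _ =
  \int[muY]_(y in A) overlap y)//.
by rewrite addrC subrK.
Qed.

Lemma dgp_dominated : outcomes_dominated muY Ps.
Proof.
move=> t; apply/null_content_dominatesP => A mA A0.
have lawA0 : law P t A = 0%E.
  by move/null_content_dominatesP : (law_dominated hZ hdom t); apply.
rewrite -[LHS](EFin_mass (distribution Ps (Ycf t)))//.
rewrite [mass _ _](_ : _ = mass Ps (Ycf t @^-1` A))//.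
by rewrite mass_dgp_Ycf//; exact: (congr1 (fun x => (fine x)%:E) lawA0).
Qed.

Lemma mass_dgp_compliers : mass Ps compliers = 1 - k * (1 - TVY P muY).
Proof.
have mT := measurable_preimage_bool (@Tstar R true) true.
transitivity (mass Ps (Tstar true @^-1` [set true])).
  rewrite /mass/= /distribution /pushforward; congr (fine (sample_law _ _ _ _)).
  by rewrite compliersE; apply/seteqP; split=> w /=; [case|split].
have := mass_bool_preimage Ps Zdgp setT mT.
rewrite preimage_setT setIT !in_setT !mul1r => ->.
have E z := @mass_dgp_type _ _ _ hZ hdom _ k01 false z true setT measurableT.
move: (E true) (E false); rewrite !preimage_setT !setTI => -> ->.
by rewrite -mulrDl pZD mul1r complier_massT.
Qed.

Lemma dgp_conditionA : conditionA Ps.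
Proof.
split.
- move=> t A B mA _; have mE := measurable_outcome_pre t mA.
  have mZ : measurable (@Zdgp R @^-1` B).
    exact: measurable_funPTI.
  rewrite -!EFin_mass//; last exact: measurableI.
  rewrite -EFinM mass_bool_preimage// !mass_dgp_outcome_Z// mass_dgp_outcome//.
  have := mass_bool_preimage Ps Zdgp B measurableT; rewrite !setTI => ->.
  have massZ z : mass Ps (Zdgp @^-1` [set z]) = pZ P z.
    by apply: mass_Zdgp => *; exact: distribution_dgp_obs.
  by rewrite !massZ; congr EFin; ring.
- exists (Tstar false @^-1` [set true]); split.
  + exact: measurable_preimage_bool.
  + transitivity (sample_law hZ hdom k set0); last exact: measure0.
    by rewrite /= /distribution /pushforward; congr (sample_law _ _ _ _);
      apply/seteqP; split.
  + move=> w; rewrite /setC/= => /negP; rewrite -ltnNge.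
    by case: w.1.2.1 => //; case: w.1.2.2.
- suff -> : Ps (Zdgp @^-1` [set false]) = P (Zobs @^-1` [set false]) by [].
  exact: (distribution_dgp_obs hZ hdom k (measurable_preimage_bool Zobs false)).
Qed.

End matching_dgp.

(** * The share of compliers and their effect *)

Section late.
Context {R : realType} (muY : {finite_measure set R -> \bar R}).
Variable P : probability (obs_space R) R.
Hypothesis hZ : (0 < P (Zobs @^-1` [set false]) < 1)%E.
Hypothesis hY : P.-integrable setT (EFin \o Yobs).
Variable Ps : probability (dgp_space R) R.
Hypothesis PsA : conditionA Ps.
Hypothesis PsP : forall A : set (obs_space R), measurable A ->
  distribution Ps obs_of A = P A.

(** The complier identity, integrated. The constructed process satisfies the same
    hypotheses, so its effect needs no separate computation. *)
Lemma LATE_dgp : 0 < mass Ps compliers ->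
  ('E_(cond_prob Ps measurable_compliers)
     [fun w => (Ycf true w - Ycf false w)%R])%E =
  (DeltaEY P / mass Ps compliers)%:E.
Proof.
set p := mass Ps compliers => p0.
pose Pc := cond_prob Ps (@measurable_compliers R).
pose G t : probability R R := distribution Pc (Ycf t).
have massG t A : measurable A -> p * mass (G t) A = Ycompliers Ps t A.
  by move=> mA; apply: mass_cond; exact: measurable_Ypre.
have hG t : has_mean (G t).
  have pV0 : 0 <= p^-1 by rewrite invr_ge0 ltW.
  apply: (has_mean_le_scale pV0) (has_mean_law hZ hY t) => A mA.
  by rewrite ler_pdivlMl// massG// (Ycompliers_le PsA PsP hZ).
have iY t : Pc.-integrable setT (fun w => (Ycf t w)%:E).
  apply/integrableP; split; first by apply/measurable_EFinP; exact: measurable_Ycf.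
  have /integrableP[_] := hG t; rewrite ge0_integral_distribution//.
  exact: measurableT_comp.
have EY t : (\int[Pc]_w (Ycf t w)%:E = (mean (G t))%:E)%E.
  rewrite -(@integral_distribution _ _ _ _ _ Pc (Ycf t) EFin)//; last exact: iY.
  by rewrite /mean /Rintegral fineK//; exact: integrable_fin_num (hG t).
rewrite unlock.
transitivity (\int[Pc]_w ((Ycf true w)%:E - (Ycf false w)%:E))%E => //.
transitivity (\int[Pc]_w (Ycf true w)%:E - \int[Pc]_w (Ycf false w)%:E)%E.
  exact: (integralB_EFin measurableT (iY true) (iY false)).
rewrite !EY -EFinB; congr EFin.
have := @mean_balance _ p (law P true) (law P false) (G true) (G false).
move=> /(_ (ltW p0) (has_mean_law hZ hY _) (has_mean_law hZ hY _) (hG _) (hG _)).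
rewrite DeltaEYE// => bal.
apply: (mulfI (lt0r_neq0 p0)); rewrite mulrCA mulfV ?gt_eqF// mulr1.
suff : mean (law P true) + p * mean (G false) =
  mean (law P false) + p * mean (G true) by lra.
by apply: bal => A mA; rewrite !massG// (law_balance PsA PsP hZ).
Qed.

Hypothesis hdom : distribution P Yobs `<< muY.

(** Evaluate the complier identity on the set where the first density exceeds the
    second: the excess, which is the total variation, sits on compliers. *)
Lemma TVY_le_compliers : TVY P muY <= mass Ps compliers.
Proof.
pose B := [set y | dens muY P false y < dens muY P true y].
have mB : measurable B.
  rewrite -[X in measurable X]setTI.
  by apply: (measurable_fun_ltr _ _ measurableT (Y := [set true])) => //;
    exact: measurable_dens.
have := integral_overlap hZ hdom; rewrite (integral_overlap_setC hZ hdom mB).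
have -> : \int[muY]_(y in B) overlap muY P y = mass (law P false) B.
  rewrite (mass_law_dens hZ hdom)//; apply: eq_Rintegral => y; rewrite inE => yB.
  by rewrite /overlap minC min_l// ltW.
have -> : \int[muY]_(y in ~` B) overlap muY P y = mass (law P true) (~` B).
  rewrite (mass_law_dens hZ hdom)//; last exact: measurableC.
  apply: eq_Rintegral => y; rewrite inE => /negP; rewrite -leNgt => yB.
  by rewrite /overlap min_l.
have := law_balance PsA PsP hZ mB.
have : mass (law P true) B + mass (law P true) (~` B) = 1.
  rewrite -massU//; last by rewrite setICr.
    by rewrite setUv massT.
  exact: measurableC.
have : Ycompliers Ps true B <= mass Ps compliers.
  apply: le_mass => //.
  by apply: measurableI; [exact: measurable_Ypre|exact: measurable_compliers].
  exact: measurable_compliers.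
have := mass_ge0 Ps (Ycf false @^-1` B `&` compliers).
rewrite -/(Ycompliers Ps false B); lra.
Qed.

Lemma mass_compliers_le1 : mass Ps compliers <= 1.
Proof.
by rewrite -(massT Ps) le_mass//; exact: measurable_compliers.
Qed.

End late.

(** * The parameter space *)

Section Theta_membership.
Context {R : realType} (muY : {finite_measure set R -> \bar R}).
Variable P : probability (obs_space R) R.
Hypothesis hZ : (0 < P (Zobs @^-1` [set false]) < 1)%E.
Hypothesis hY : P.-integrable setT (EFin \o Yobs).
Hypothesis hdom : distribution P Yobs `<< muY.

Lemma TVY_ge0 : 0 <= TVY P muY.
Proof. by rewrite mulr_ge0// Rintegral_ge0. Qed.

Lemma TVY_le1 : TVY P muY <= 1.
Proof.
have : 0 <= 1 - TVY P muY; last by rewrite subr_ge0.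
rewrite -(integral_overlap hZ hdom).
by apply: Rintegral_ge0 => y _; exact: overlap_ge0.
Qed.

Variable k : R.
Hypothesis k01 : 0 <= k <= 1.
Local Notation p := (1 - k * (1 - TVY P muY)).
Hypothesis p0 : 0 < p.

(* The normalized complier densities. *)
Let h t y := p^-1 * (dens muY P t y - k * overlap muY P y).

Let h_ge0 t y : 0 <= h t y.
Proof.
apply: mulr_ge0; first by rewrite invr_ge0 ltW.
rewrite subr_ge0.
have := overlap_ge0 hZ hdom y; have := overlap_le muY P t y.
by case/andP : k01; nra.
Qed.

Let h_le t y : h t y <= p^-1 * dens muY P t y.
Proof.
rewrite /h ler_pM2l ?invr_gt0// gerBl.
by case/andP: k01 => k0 _; rewrite mulr_ge0// (overlap_ge0 hZ hdom).
Qed.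

Let mh t : measurable_fun setT (h t).
Proof.
apply: measurable_funM => //; apply: measurable_funB.
  exact: measurable_dens.
by apply: measurable_funM => //; exact: measurable_overlap.
Qed.

Let iyh t : muY.-integrable setT (fun y => (y * h t y)%:E).
Proof.
have i := integrable_mul_dens hZ hdom (has_mean_law hZ hY t).
apply: le_integrable (integrableZl measurableT p^-1 i) => //.
  by apply/measurable_EFinP/measurable_funM => //; exact: mh.
move=> y _; rewrite lee_fin.
have -> : `|y * h t y| = `|y| * h t y by rewrite normrM (ger0_norm (h_ge0 t y)).
rewrite [X in _ <= `|X|]mulrCA [leRHS]normrM; apply: ler_wpM2l => //.
exact: le_trans (h_le t y) (ler_norm _).
Qed.

Let h_density t : is_integrable_density muY (h t).
Proof.
split; [exact: mh|exact: h_ge0| |exact: iyh].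
have io := integrable_overlap hZ hdom.
have id := integrable_dens hZ hdom t.
have ih : muY.-integrable setT (fun y => (h t y)%:E).
  apply: (integrableZl measurableT p^-1 (integrableB measurableT id
    (integrableZl measurableT k io))).
transitivity ((\int[muY]_y h t y)%:E).
  by rewrite /Rintegral fineK// integrable_fin_num.
congr EFin; rewrite RintegralZl//; last first.
  exact: (integrableB measurableT id (integrableZl measurableT k io)).
rewrite RintegralB//; last exact: (integrableZl measurableT k io).
rewrite RintegralZl// -(mass_law_dens hZ hdom)// massT integral_overlap//.
by rewrite mulVf ?gt_eqF.
Qed.

Lemma Theta_DeltaEY : Theta muY (DeltaEY P / p).
Proof.
exists (h true), (h false); split=> //.
rewrite -RintegralB//; [|exact: iyh..].
have iyd t := integrable_mul_dens hZ hdom (has_mean_law hZ hY t).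
rewrite DeltaEYE// !(mean_law hZ hdom)//; try exact: has_mean_law.
transitivity (\int[muY]_y
  (p^-1 * (y * dens muY P true y - y * dens muY P false y))).
  rewrite RintegralZl//; last exact: (integrableB measurableT (iyd true) (iyd false)).
  by rewrite (RintegralB measurableT (iyd _) (iyd _)) mulrC.
by apply: eq_Rintegral => y _; rewrite /h; ring.
Qed.

End Theta_membership.

(** * The identified set *)

(** As [p] runs over [[TV, 1]] its inverse runs over the interval from [1] to
    [TV^-1]; the sign of [D] then decides which endpoint is the larger one. *)
Lemma ratio_range (R : realFieldType) (D TV x : R) : 0 < TV <= 1 ->
  (exists2 p, TV <= p <= 1 & x = D / p) <->
  (if 0 < D then `[D, D / TV]%classic
   else if D == 0 then [set 0] else `[D / TV, D]%classic) x.
Proof.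
case/andP=> TV0 TV1.
split=> [[p /andP[TVp p1] ->]|].
  have p0 : 0 < p by exact: lt_le_trans TVp.
  have pV1 : 1 <= p^-1 by rewrite invf_ge1.
  have pVTV : p^-1 <= TV^-1 by rewrite lef_pV2.
  case: ltgtP => [D0|D0|<-] /=; last by rewrite mul0r.
    by rewrite in_itv/= ler_pMr// pV1 ler_pM2l.
  by rewrite in_itv/= ler_nM2l// pVTV ger_nMr.
case: ltgtP => [D0|D0|<-] /=.
- rewrite in_itv/= => /andP[Dx xD]; have x0 : 0 < x by exact: lt_le_trans Dx.
  exists (D / x); last by rewrite invf_div mulrC divfK ?gt_eqF.
  by rewrite ler_pdivlMr// ler_pdivrMr// mul1r Dx andbT -ler_pdivlMl// mulrC.
- rewrite in_itv/= => /andP[Dx xD]; have x0 : x < 0 by exact: le_lt_trans D0.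
  exists (D / x); last by rewrite invf_div mulrC divfK ?lt_eqF.
  by rewrite ler_ndivlMr// ler_ndivrMr// mul1r xD andbT -ler_pdivrMl// mulrC.
- by move=> ->; exists 1; rewrite ?mul0r// TV1 lexx.
Qed.

Theorem theorem11 (R : realType) (muY : {finite_measure set R -> \bar R})
    (P : probability (obs_space R) R)
    (hZ : (0 < P (Zobs @^-1` [set false]) < 1)%E)
    (hY : P.-integrable setT (EFin \o Yobs))
    (hdom : distribution P Yobs `<< muY) :
  let DE := DeltaEY P in
  let TV := TVY P muY in
  Theta_I muY P =
    if TV == 0 then Theta muY
    else if 0 < DE then `[DE, DE / TV]%classic
    else if DE == 0 then [set 0]
    else `[DE / TV, DE]%classic.
Proof.
move=> DE TV; have TV1 : TV <= 1 := TVY_le1 hZ hdom.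
have mC := @measurable_compliers R.
have compl0 (Ps : probability (dgp_space R) R) :
    (Ps compliers == 0%E) = (mass Ps compliers == 0).
  by rewrite -[X in X == 0%E](EFin_mass Ps mC) eqe.
case: ifPn => [/eqP TV0|TVneq0].
  apply/seteqP; split=> [theta []//|theta Th]; split=> //.
  (* The whole overlap goes to the never-takers, and no complier is left. *)
  pose k : R := 1; have k01 : 0 <= k <= 1 by rewrite /k ler01 lexx.
  exists (dgp hZ hdom k); split.
  - exact: dgp_dominated.
  - exact: dgp_conditionA.
  - by move=> A mA; exact: distribution_dgp_obs.
  - rewrite /is_LATE compl0 mass_dgp_compliers// -/TV TV0 subr0 mulr1 subrr eqxx.
    exact: Th.
have TV0 : 0 < TV by rewrite lt_neqAle eq_sym TVneq0 TVY_ge0.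
apply/seteqP; split=> theta.
  move=> [_ [Ps [_ PsA PsP]]].
  have TVp := TVY_le_compliers hZ PsA PsP hdom.
  have p0 : 0 < mass Ps compliers by exact: lt_le_trans TVp.
  rewrite /is_LATE compl0 gt_eqF// (LATE_dgp hZ hY PsA PsP p0) => -[thetaE].
  apply/(ratio_range _ _ (introT andP (conj TV0 TV1))).
  exists (mass Ps compliers) => //.
  by rewrite TVp mass_compliers_le1.
move=> /(ratio_range _ _ (introT andP (conj TV0 TV1)))[p /andP[TVp p1] ->].
(* Solves [1 - k * (1 - TV) = p]; for [TV = 1] it is the convention 1 / 0 = 0 that
   gives the right value [k = 0]. *)
pose k := (1 - p) / (1 - TV).
have k01 : 0 <= k <= 1.
  rewrite /k divr_ge0 ?subr_ge0//=; have [TVE|TVn1] := eqVneq TV 1.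
    by rewrite TVE subrr invr0 mulr0 ler01.
  by rewrite ler_pdivrMr ?subr_gt0 ?lt_neqAle ?TVn1// mul1r lerB.
have pE : 1 - k * (1 - TV) = p.
  have [TVE|TVn1] := eqVneq TV 1.
    by rewrite TVE subrr mulr0 subr0; apply/le_anti; rewrite -{1}TVE TVp p1.
  by rewrite divfK ?subr_eq0 1?eq_sym//; ring.
have p0 : 0 < p by exact: lt_le_trans TVp.
have PsA := dgp_conditionA hZ hdom k01.
have PsP A (mA : measurable A) := distribution_dgp_obs hZ hdom k mA.
have compE : mass (dgp hZ hdom k) compliers = p by rewrite mass_dgp_compliers.
split.
  by have := Theta_DeltaEY hZ hY hdom k01; rewrite -/TV pE; exact.
exists (dgp hZ hdom k); split=> //; first exact: dgp_dominated.
rewrite /is_LATE compl0 compE gt_eqF//.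
by rewrite (LATE_dgp hZ hY PsA PsP) compE.
Qed.
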